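(* Let $\Phi\colon M\to N$ be a map from a super Riemann surface $M$ into a Kähler manifold $(N,\omega,J)$. Then $\Phi$ is a super $J$-holomorphic curve if and only if $\Phi$ is a holomorphic map.
   Context: All supermanifolds are families over a base supermanifold $B$; everything is relative to $B$. A super Riemann surface is a complex supermanifold $M$ of dimension $1|1$ with a holomorphic distribution $\mathcal D\subset TM$ of rank $0|1$ such that $\frac12[\cdot,\cdot]\colon\mathcal D\otimes\mathcal D\to TM/\mathcal D$ is an isomorphism; $I$ is its almost complex structure. A smooth map $\Phi\colon M\to N$ is a super $J$-holomorphic curve if $\overline D_J\Phi=\frac12(d\Phi+J\circ d\Phi\circ I)|_{\mathcal D}\in\Gamma(\mathcal D^\vee\otimes\Phi^*TN)$ vanishes (a condition only on $\mathcal D$, not on all of $TM$). *)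

(* Defs.v *)
From HB Require Import structures.
From mathcomp Require Import all_boot all_order all_algebra.
From mathcomp Require Import all_classical all_reals all_analysis.

Set Implicit Arguments.
Unset Strict Implicit.
Unset Printing Implicit Defensive.

Import Order.TTheory GRing.Theory Num.Theory.
Import numFieldNormedType.Exports.
Local Open Scope classical_set_scope.
Local Open Scope ring_scope.

(** A topological space with a sheaf of supercommutative R-algebras.  [sec]
    and [res] are total on arbitrary sets, so that no open-set proofs occur in
    types; only their values on open sets (and on inclusions) are constrained.
    Section rings are [pzRingType]s because the sections over [set0] form the
    zero ring; the R-algebra structure is the ring morphism [cst], whose image
    is central since it is even.  The parity [false] is even, [true] is odd. *)
Record superspace (R : realType) := Superspace {
  points :> topologicalType ;
  sec : set points -> pzRingType ;
  cst : forall U : set points, {rmorphism R -> sec U} ;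
  par : forall U : set points, bool -> set (sec U) ;
  res_to : forall U V : set points, sec U -> sec V ;

  par0 : forall U p, open U -> par p (0 : sec U) ;
  parB : forall U p (s t : sec U), open U ->
    par p s -> par p t -> par p (s - t) ;
  parM : forall U p q (s t : sec U), open U ->
    par p s -> par q t -> par (p (+) q) (s * t) ;
  par_cst : forall U (a : R), open U -> par false (cst U a) ;
  par_split : forall U (s : sec U), open U ->
    exists s0 s1 : sec U, [/\ par false s0, par true s1 & s = s0 + s1] ;
  par_direct : forall U (s : sec U), open U ->
    par false s -> par true s -> s = 0 ;
  supercomm : forall U p q (s t : sec U), open U ->
    par p s -> par q t -> s * t = (-1) ^+ (p && q) * (t * s) ;

  resD : forall U V (s t : sec U), open U -> open V -> V `<=` U ->
    res_to V (s + t) = res_to V s + res_to V t ;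
  resM : forall U V (s t : sec U), open U -> open V -> V `<=` U ->
    res_to V (s * t) = res_to V s * res_to V t ;
  res_cst : forall U V (a : R), open U -> open V -> V `<=` U ->
    res_to V (cst U a) = cst V a ;
  res_par : forall U V p (s : sec U), open U -> open V -> V `<=` U ->
    par p s -> par p (res_to V s) ;
  res_id : forall U (s : sec U), open U -> res_to U s = s ;
  res_comp : forall U V W (s : sec U), open U -> open V -> open W ->
    V `<=` U -> W `<=` V -> res_to W (res_to V s) = res_to W s ;

  sheaf_separated : forall U (s t : sec U), open U ->
    (forall x, U x -> exists V : set points,
        [/\ open V, V x, V `<=` U & res_to V s = res_to V t]) ->
    s = t ;
  sheaf_glue : forall (I : Type) (V : I -> set points)
      (s : forall i, sec (V i)),
    (forall i, open (V i)) ->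
    (forall i j, res_to (V i `&` V j) (s i) = res_to (V i `&` V j) (s j)) ->
    exists t : sec (\bigcup_i V i), forall i, res_to (V i) t = s i
}.

Arguments sec {R} s U : rename.
Arguments cst {R s} U : rename.
Arguments par {R s U} p f : rename.

Definition res {R : realType} {M : superspace R} {U : set M} (V : set M)
  (s : sec M U) : sec M V := res_to V s.

Definition invertible_near {R : realType} {M : superspace R} {U : set M}
    (s : sec M U) (x : M) : Prop :=
  exists V : set M, [/\ open V, V x, V `<=` U &
    exists t : sec M V, res V s * t = 1 /\ t * res V s = 1].

(** The value at [x] of a superfunction is the real number [r] such that
    [s - r] vanishes in the residue field of the local ring at [x]. *)
Definition value_at {R : realType} {M : superspace R} {U : set M}
    (s : sec M U) (x : M) (r : R) : Prop :=
  ~ invertible_near (s - cst U r) x.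

Record morphism {R : realType} (M N : superspace R) := Morphism {
  base_map :> M -> N ;
  pull : forall V : set N, sec N V -> sec M (base_map @^-1` V) ;
  base_map_continuous : continuous base_map ;
  pullD : forall V (s t : sec N V), open V ->
    pull (s + t) = pull s + pull t ;
  pullM : forall V (s t : sec N V), open V ->
    pull (s * t) = pull s * pull t ;
  pull_cst : forall V (a : R), open V -> pull (cst V a) = cst _ a ;
  pull_par : forall V p (s : sec N V), open V -> par p s -> par p (pull s) ;
  pull_res : forall V W (s : sec N V), open V -> open W -> W `<=` V ->
    pull (res W s) = res _ (pull s) ;
  pull_local : forall V (s : sec N V) x, open V -> V (base_map x) ->
    invertible_near (pull s) x -> invertible_near s (base_map x)
}.

Arguments pull {R M N} _ {V} s : rename.

Definition e_ {R : realType} {m : nat} (i : 'I_m) : 'rV[R]_m := delta_mx 0 i.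

Fixpoint Cn_on {R : realType} {m : nat} (k : nat) (V : set 'rV[R]_m)
    (f : 'rV[R]_m -> R) : Prop :=
  (forall y, V y -> {for y, continuous f}) /\
  if k is k'.+1 then
    forall i : 'I_m, (forall y, V y -> derivable f y (e_ i)) /\
                     Cn_on k' V (fun y => 'D_(e_ i) f y)
  else True.

Definition smooth_on {R : realType} {m : nat} (V : set 'rV[R]_m)
    (f : 'rV[R]_m -> R) : Prop := forall k, Cn_on k V f.

Definition superpoly {R : realType} {M : superspace R} {m n : nat}
    (W : set M) (pul : ('rV[R]_m -> R) -> sec M W) (th : 'I_n -> sec M W)
    (f : {set 'I_n} -> 'rV[R]_m -> R) : sec M W :=
  \sum_(S : {set 'I_n}) pul (f S) * \prod_(j in S) th j.

(** An isomorphism of the restriction of [M] to [dom] with an open piece of the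
    model (R^m, C^oo (x) Lambda(R^n)).  [crd] is the homeomorphism, [smf] the
    embedding of the smooth functions, [ocrd] the odd generators.  By
    supercommutativity the algebra structure of the model is determined by the
    unique expansion of each section as sum_S f_S theta^S.  Functions on an open
    subset of R^m are represented by total functions, hence [smf_ext]. *)
Record chart {R : realType} (M : superspace R) (m n : nat) := Chart {
  dom : set M ;
  crd : M -> 'rV[R]_m ;
  smf : forall W : set M, ('rV[R]_m -> R) -> sec M W ;
  ocrd : 'I_n -> sec M dom ;

  dom_open : open dom ;
  crd_continuous : forall x, dom x -> {for x, continuous crd} ;
  crd_inj : forall x y, dom x -> dom y -> crd x = crd y -> x = y ;
  crd_open : forall W : set M, open W -> W `<=` dom -> open (crd @` W) ;

  smf_ext : forall W f g, open W -> W `<=` dom ->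
    smooth_on (crd @` W) f -> smooth_on (crd @` W) g ->
    (forall y, (crd @` W) y -> f y = g y) -> smf W f = smf W g ;
  smf_cst : forall W a, open W -> W `<=` dom ->
    smf W (fun=> a) = cst W a ;
  smfD : forall W f g, open W -> W `<=` dom ->
    smooth_on (crd @` W) f -> smooth_on (crd @` W) g ->
    smf W (fun y => f y + g y) = smf W f + smf W g ;
  smfM : forall W f g, open W -> W `<=` dom ->
    smooth_on (crd @` W) f -> smooth_on (crd @` W) g ->
    smf W (fun y => f y * g y) = smf W f * smf W g ;
  smf_even : forall W f, open W -> W `<=` dom ->
    smooth_on (crd @` W) f -> par false (smf W f) ;
  smf_res : forall W W' f, open W -> W `<=` dom -> open W' -> W' `<=` W ->
    smooth_on (crd @` W) f -> res W' (smf W f) = smf W' f ;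
  ocrd_odd : forall j, par true (ocrd j) ;

  expansion : forall W (s : sec M W), open W -> W `<=` dom ->
    exists f : {set 'I_n} -> 'rV[R]_m -> R,
      (forall S, smooth_on (crd @` W) (f S)) /\
      s = superpoly (smf W) (fun j => res W (ocrd j)) f ;
  expansion_unique : forall W (f : {set 'I_n} -> 'rV[R]_m -> R),
    open W -> W `<=` dom -> (forall S, smooth_on (crd @` W) (f S)) ->
    superpoly (smf W) (fun j => res W (ocrd j)) f = 0 ->
    forall S y, (crd @` W) y -> f S y = 0
}.

Definition ecrd {R : realType} {M : superspace R} {m n : nat}
    (c : chart M m n) (i : 'I_m) : sec M (dom c) :=
  smf c (dom c) (fun y => y 0 i).

Record supermanifold (R : realType) (m n : nat) := Supermanifold {
  space :> superspace R ;
  space_hausdorff : hausdorff_space space ;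
  space_countable : @second_countable space ;
  space_charts : forall x : space,
    exists c : chart space m n, dom c x
}.

(** Local coordinates in which [pi] is the projection (y, x) |-> y. *)
Record rel_chart {R : realType} {k l m n : nat} (B : supermanifold R k l)
    (M : supermanifold R (k + m) (l + n)) (pi : morphism M B) := RelChart {
  bchart : chart B k l ;
  tchart :> chart M (k + m) (l + n) ;
  rel_dom : dom tchart `<=` pi @^-1` dom bchart ;
  rel_even : forall i : 'I_k,
    ecrd tchart (lshift m i) = res _ (pull pi (ecrd bchart i)) ;
  rel_odd : forall j : 'I_l,
    ocrd tchart (lshift n j) = res _ (pull pi (ocrd bchart j))
}.

Record family {R : realType} {k l : nat} (B : supermanifold R k l)
    (m n : nat) := Family {
  total :> supermanifold R (k + m) (l + n) ;
  proj : morphism total B ;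
  proj_submersion : forall x : total,
    exists c : rel_chart proj, dom c x
}.

(** The relative coordinates, even ones first. *)
Definition rcrd {R : realType} {k l m n : nat} {B : supermanifold R k l}
    {M : family B m n} (c : rel_chart (proj M)) (i : 'I_m + 'I_n) :
    sec M (dom c) :=
  match i with
  | inl a => ecrd c (rshift k a)
  | inr b => ocrd c (rshift l b)
  end.

Record family_map {R : realType} {k l m n m' n' : nat}
    {B : supermanifold R k l} (M : family B m n) (N : family B m' n') :=
  FamilyMap {
    fmap_mor :> morphism M N ;
    fmap_base : forall x, proj N (fmap_mor x) = proj M x ;
    fmap_pull : forall (W : set B) (b : sec B W), open W ->
      res (proj M @^-1` W) (pull fmap_mor (pull (proj N) b)) =
      pull (proj M) b
  }.

(** A section over [U] of the relative tangent sheaf T(M/B) is a derivation of the sheaf restricted to [U] that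
    annihilates the functions of the base.  It is represented by an operator on
    all section rings, of which only the components at open subsets of [U]
    matter ([op_eq]). *)
Definition op {R : realType} (M : superspace R) := forall V, sec M V -> sec M V.

Definition op_eq {R : realType} {M : superspace R} (U : set M) (X Y : op M) :=
  forall V (s : sec M V), open V -> V `<=` U -> X V s = Y V s.

Definition opD {R : realType} {M : superspace R} (X Y : op M) : op M :=
  fun V s => X V s + Y V s.
Definition opB {R : realType} {M : superspace R} (X Y : op M) : op M :=
  fun V s => X V s - Y V s.
Definition opN {R : realType} {M : superspace R} (X : op M) : op M :=
  fun V s => - X V s.
Definition opM {R : realType} {M : superspace R} {U : set M} (f : sec M U)
    (X : op M) : op M := fun V s => res V f * X V s.
Definition opZ {R : realType} {M : superspace R} (a : R) (X : op M) : op M :=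
  fun V s => cst V a * X V s.
Arguments opM {R M U} f X V s.

Definition op_comb {R : realType} {M : superspace R} {U : set M} {I : finType}
    (f : I -> sec M U) (E : I -> op M) : op M :=
  fun V s => \sum_i opM (f i) (E i) V s.

(** The supercommutator of operators of parities [p] and [q]. *)
Definition bracket {R : realType} {M : superspace R} (p q : bool)
    (X Y : op M) : op M :=
  fun V s => X V (Y V s) - (-1) ^+ (p && q) * Y V (X V s).

Record vfield {R : realType} {k l m n : nat} {B : supermanifold R k l}
    (M : family B m n) (p : bool) (U : set M) (X : op M) : Prop := VField {
  vf_add : forall V (s t : sec M V), open V -> V `<=` U ->
    X V (s + t) = X V s + X V t ;
  vf_leibniz : forall V q (s t : sec M V), open V -> V `<=` U -> par q s ->
    X V (s * t) = X V s * t + (-1) ^+ (p && q) * (s * X V t) ;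
  vf_par : forall V q (s : sec M V), open V -> V `<=` U -> par q s ->
    par (p (+) q) (X V s) ;
  vf_res : forall V V' (s : sec M V), open V -> V `<=` U ->
    open V' -> V' `<=` V -> X V' (res V' s) = res V' (X V s) ;
  vf_rel : forall V W (b : sec B W), open V -> V `<=` U ->
    open W -> V `<=` proj M @^-1` W -> X V (res V (pull (proj M) b)) = 0
}.

Record local_frame {R : realType} {k l m n : nat} {B : supermanifold R k l}
    (M : family B m n) (U : set M) (I : finType) (d : I -> bool)
    (E : I -> op M) : Prop := LocalFrame {
  frame_vf : forall i, vfield (d i) U (E i) ;
  frame_span : forall V p (X : op M), open V -> V `<=` U -> vfield p V X ->
    exists f : I -> sec M V,
      (forall i, par (p (+) d i) (f i)) /\ op_eq V X (op_comb f E) ;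
  frame_free : forall V (f : I -> sec M V), open V -> V `<=` U ->
    op_eq V (op_comb f E) (fun _ _ => 0) -> forall i, f i = 0
}.

(** The coordinate vector fields of a relative chart: the local frame of T(M/B)
    dual to the differentials of the relative coordinates. *)
Definition coordinate_frame {R : realType} {k l m n : nat}
    {B : supermanifold R k l} {M : family B m n} (c : rel_chart (proj M))
    (E : 'I_m + 'I_n -> op M) : Prop :=
  local_frame (dom c) (fun i => if i is inr _ then true else false) E /\
  forall i j, E i (dom c) (rcrd c j) = (i == j)%:R.

(** [I] is an endomorphism of the sheaf T(M/B): the section [I X] over [U] depends
    only on [X] over [U]. *)
Record almost_complex {R : realType} {k l m n : nat} {B : supermanifold R k l}
    (M : family B m n) (I : op M -> op M) : Prop := AlmostComplex {
  ac_vf : forall U p X, open U -> vfield p U X -> vfield p U (I X) ;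
  ac_ext : forall U p X Y, open U -> vfield p U X -> vfield p U Y ->
    op_eq U X Y -> op_eq U (I X) (I Y) ;
  ac_add : forall U p X Y, open U -> vfield p U X -> vfield p U Y ->
    op_eq U (I (opD X Y)) (opD (I X) (I Y)) ;
  ac_mul : forall U p q (f : sec M U) X, open U -> par q f -> vfield p U X ->
    op_eq U (I (opM f X)) (opM f (I X)) ;
  ac_square : forall U p X, open U -> vfield p U X ->
    op_eq U (I (I X)) (opN X)
}.

Definition re_index {a b : nat} (i : 'I_a + 'I_b) :
    'I_(a + a) + 'I_(b + b) :=
  match i with inl x => inl (lshift a x) | inr y => inr (lshift b y) end.
Definition im_index {a b : nat} (i : 'I_a + 'I_b) :
    'I_(a + a) + 'I_(b + b) :=
  match i with inl x => inl (rshift a x) | inr y => inr (rshift b y) end.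

(** Complex supermanifolds of dimension a|b over [B]: around every point there
    are relative complex coordinates z = x + iy, theta = xi + i eta, with the
    real coordinates ordered as (x, y | xi, eta), such that I d/dx = d/dy and
    I d/dxi = d/deta; that is, [M] is locally C^(a|b) x B with its standard
    complex structure. *)
Record complex_family {R : realType} {k l : nat} (B : supermanifold R k l)
    (a b : nat) := ComplexFamily {
  cfam :> family B (a + a) (b + b) ;
  cJ : op cfam -> op cfam ;
  cJ_almost_complex : almost_complex cJ ;
  cJ_integrable : forall x : cfam,
    exists (c : rel_chart (proj cfam))
           (E : 'I_(a + a) + 'I_(b + b) -> op cfam),
      [/\ dom c x, coordinate_frame c E &
          forall i, op_eq (dom c) (cJ (E (re_index i))) (E (im_index i))]
}.

(** A real vector field on a complex supermanifold whose (1,0)-part is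
    holomorphic, i.e. whose Lie derivative annihilates the complex structure. *)
Definition holomorphic_field {R : realType} {k l a b : nat}
    {B : supermanifold R k l} (M : complex_family B a b) (p : bool)
    (U : set M) (X : op M) : Prop :=
  vfield p U X /\
  forall V q (Y : op M), open V -> V `<=` U -> vfield q V Y ->
    op_eq V (bracket p q X (cJ Y)) (cJ (bracket p q X Y)).

Arguments cJ {R k l B a b c} X V s : rename.

(** (f + i g) X, complex scalars acting on real vector fields through [cJ]. *)
Definition cmul {R : realType} {k l a b : nat} {B : supermanifold R k l}
    {M : complex_family B a b} {U : set M} (f g : sec M U) (X : op M) : op M :=
  opD (opM f X) (opM g (cJ X)).

(** [X] is a local basis over [U], for complex-valued coefficients, of the
    subsheaf [D], of rank 0|1. *)
Record odd_generator {R : realType} {k l a b : nat} {B : supermanifold R k l}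
    (M : complex_family B a b) (D : forall U : set M, set (op M))
    (U : set M) (X : op M) : Prop := OddGenerator {
  gen_vf : vfield true U X ;
  gen_span : forall V p (Y : op M), open V -> V `<=` U -> vfield p V Y ->
    (D V Y <-> exists f g : sec M V,
       [/\ par (~~ p) f, par (~~ p) g & op_eq V Y (cmul f g X)]) ;
  gen_free : forall V (f g : sec M V), open V -> V `<=` U ->
    op_eq V (cmul f g X) (fun _ _ => 0) -> f = 0 /\ g = 0
}.

(** Holomorphic distributions of rank 0|1 in T(M/B), for [M] of dimension 1|1:
    subsheaves locally generated by an odd holomorphic vector field, and locally
    a direct summand.  The sections over [U] of the distribution are the vector
    fields on [U] that belong to [D U]. *)
Record holomorphic_distribution {R : realType} {k l : nat}
    {B : supermanifold R k l} (M : complex_family B 1 1)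
    (D : forall U : set M, set (op M)) : Prop := HolomorphicDistribution {
  distr_local : forall U p X, open U -> vfield p U X ->
    (D U X <-> forall x, U x -> exists V : set M,
                 [/\ open V, V x, V `<=` U & D V X]) ;
  distr_generator : forall x : M, exists (U : set M) (X W : op M),
    [/\ open U, U x, odd_generator D U X, holomorphic_field true U X &
        local_frame U (fun i : bool * bool => i.1)
          (fun i => let Z := if i.1 then X else W in
                    if i.2 then cJ Z else Z)]
}.

(** The map (1/2)[.,.] from the complex tensor square of [D] to TM/D is an
    isomorphism of complex bundles: the class of (1/2)[X,X], which is the image
    of the local basis X (x) X of the tensor square, is a local basis of TM/D. *)
Definition maximally_nonintegrable {R : realType} {k l : nat}
    {B : supermanifold R k l} (M : complex_family B 1 1)
    (D : forall U : set M, set (op M)) : Prop :=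
  forall (U : set M) (X : op M), open U -> odd_generator D U X ->
  let H := opZ 2^-1 (bracket true true X X) in
  forall (V : set M) p, open V -> V `<=` U ->
  (forall Y : op M, vfield p V Y -> exists f g : sec M V,
     [/\ par p f, par p g & D V (opB Y (cmul f g H))]) /\
  (forall f g : sec M V, par p f -> par p g ->
     D V (cmul f g H) -> f = 0 /\ g = 0).

Record super_Riemann_surface {R : realType} {k l : nat}
    (B : supermanifold R k l) := SuperRiemannSurface {
  srs :> complex_family B 1 1 ;
  srs_D : forall U : set srs, set (op srs) ;
  srs_distribution : holomorphic_distribution srs_D ;
  srs_nonintegrable : maximally_nonintegrable srs_D
}.

Arguments srs_D {R k l B s} U X : rename.

(** The tangent vector at [x] of a vector field on [U] is nonzero. *)
Definition nonzero_at {R : realType} {M : superspace R} (U : set M)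
    (X : op M) (x : M) : Prop :=
  exists (V : set M) (s : sec M V) (r : R),
    [/\ open V, V x, V `<=` U, value_at (X V s) x r & r != 0].

(** A Kaehler manifold is a family over [B] like every other object, an
    ordinary Kaehler manifold N0 being the constant family N0 x B: complex
    families of dimension n|0 with a closed 2-form [om] on T(N/B) that
    is compatible with J: om(JX,JY) = om(X,Y) and om(X,JX) > 0 for X <> 0.
    For the relative dimension n|0, T(N/B) is locally spanned by even fields, so
    that a (super) 2-form is given by its values on those; no signs occur. *)
Record Kaehler_form {R : realType} {k l n : nat} {B : supermanifold R k l}
    (N : complex_family B n 0) (om : op N -> op N -> forall V, sec N V) :
    Prop := KaehlerForm {
  om_even : forall V X Y, open V -> vfield false V X -> vfield false V Y ->
    par false (om X Y V) ;
  om_res : forall V V' X Y, open V -> open V' -> V' `<=` V ->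
    vfield false V X -> vfield false V Y ->
    res V' (om X Y V) = om X Y V' ;
  om_ext : forall V X X' Y, open V ->
    vfield false V X -> vfield false V X' -> vfield false V Y ->
    op_eq V X X' -> om X Y V = om X' Y V ;
  om_add : forall V X X' Y, open V ->
    vfield false V X -> vfield false V X' -> vfield false V Y ->
    om (opD X X') Y V = om X Y V + om X' Y V ;
  om_mul : forall V (f : sec N V) X Y, open V -> par false f ->
    vfield false V X -> vfield false V Y ->
    om (opM f X) Y V = f * om X Y V ;
  om_skew : forall V X Y, open V -> vfield false V X -> vfield false V Y ->
    om X Y V = - om Y X V ;
  om_closed : forall V X Y Z, open V ->
    vfield false V X -> vfield false V Y -> vfield false V Z ->
    X V (om Y Z V) - Y V (om X Z V) + Z V (om X Y V)
    - om (bracket false false X Y) Z V + om (bracket false false X Z) Y V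
    - om (bracket false false Y Z) X V = 0 ;
  om_invariant : forall V X Y, open V ->
    vfield false V X -> vfield false V Y ->
    om (cJ X) (cJ Y) V = om X Y V ;
  om_positive : forall V X x r, open V -> V x -> vfield false V X ->
    nonzero_at V X x -> value_at (om X (cJ X) V) x r -> 0 < r
}.

Record Kaehler_family {R : realType} {k l : nat} (B : supermanifold R k l)
    (n : nat) := KaehlerFamily {
  kfam :> complex_family B n 0 ;
  kform : op kfam -> op kfam -> forall V, sec kfam V ;
  kform_Kaehler : Kaehler_form kform
}.

(** Sections over [U] of Phi^*TN = O_M (x) Phi^{-1}T(N/B), represented by the
    derivations along Phi that they define: h (x) Y is f |-> h * Phi^#(Y f). *)
Definition along {R : realType} {M N : superspace R} (phi : morphism M N)
    (U : set M) := forall V : set N, sec N V -> sec M (U `&` phi @^-1` V).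

(** dPhi X, i.e. f |-> X (Phi^# f). *)
Definition differential {R : realType} {M N : superspace R}
    (phi : morphism M N) (U : set M) (X : op M) : along phi U :=
  fun V f => X _ (res (U `&` phi @^-1` V) (pull phi f)).

Arguments differential {R M N} phi U X V f : rename.

(** [is_J v w] is the graph w = J v of the O_M-linear extension
    h (x) Y |-> h (x) JY of J to Phi^*TN: locally v = sum h_i (x) Y_i and
    w = sum h_i (x) J Y_i. *)
Definition is_J {R : realType} {k l m n a b : nat} {B : supermanifold R k l}
    {M : family B m n} {N : complex_family B a b} (phi : morphism M N)
    (U : set M) (v w : along phi U) : Prop :=
  forall x, U x ->
  exists (U' : set M) (W : set N) (r : nat) (h : 'I_r -> sec M U')
         (d : 'I_r -> bool) (Y : 'I_r -> op N),
    [/\ open U' /\ open W, U' x, U' `<=` U, U' `<=` phi @^-1` W &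
    (forall i, vfield (d i) W (Y i)) /\
    forall (V : set N) (f : sec N V), open V -> V `<=` W ->
      let A := U' `&` phi @^-1` V in
      res A (v V f) = \sum_i res A (h i) * res A (pull phi (Y i V f)) /\
      res A (w V f) = \sum_i res A (h i) * res A (pull phi (cJ (Y i) V f))].

(** (1/2)(dPhi + J dPhi I) vanishes on the sections of D. *)
Definition super_J_holomorphic {R : realType} {k l n : nat}
    {B : supermanifold R k l} (M : super_Riemann_surface B)
    (N : Kaehler_family B n) (Phi : family_map M N) : Prop :=
  forall (U : set M) p (X : op M), open U -> vfield p U X -> srs_D U X ->
  exists JdPhiI : along Phi U,
    is_J (differential Phi U (cJ X)) JdPhiI /\
    forall (V : set N) (f : sec N V), open V ->
      cst _ 2^-1 * (differential Phi U X V f + JdPhiI V f) = 0.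

(** The differential is complex linear on T(M/B): J dPhi = dPhi I. *)
Definition holomorphic_map {R : realType} {k l a b a' b' : nat}
    {B : supermanifold R k l} (M : complex_family B a b)
    (N : complex_family B a' b') (Phi : family_map M N) : Prop :=
  forall (U : set M) p (X : op M), open U -> vfield p U X ->
    is_J (differential Phi U X) (differential Phi U (cJ X)).

(* Main.v *)
Require Import Defs.
From mathcomp Require Import all_boot all_order all_algebra.
From mathcomp Require Import all_classical all_reals all_analysis.

(** Write I and J for the complex structures of M and N.  If the differential
    is complex linear, then J dPhi I X = dPhi I I X = - dPhi X for every vector
    field X, in particular for the sections of D.

    Conversely, let X be a local odd holomorphic generator of D and
    H = X^2 = (1/2) [X, X].  By nonintegrability every vector field is a
    combination, with complex-valued coefficients, of X and H.  Complex
    linearity is inherited by such combinations ([related_cmul], [relatedD]), so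
    it remains to prove dPhi I Z = J dPhi Z for Z = X, which is the hypothesis
    up to a rotation by I ([generator_related]), and for Z = H.

    Let y_i be the pulled-back complex coordinates of N and F_i the coordinate
    fields of N.  The relation w = J v between sections of Phi^*TN amounts to
    the chain rule v(f) = sum_i v(y_i) Phi^#(F_i f), the same for w, and the
    equations that express the w(y_i) through the v(y_i) up to a sign
    ([is_J_complex_related], [is_J_differential]).  The hypothesis on X places
    dPhi X and dPhi I X in O_M (x) Phi^{-1} TN, which is the chain rule for X
    and I X.

    For the even fields H and I H = (1/2) [X, I X], the latter equality because
    X is holomorphic, the chain rule follows by differentiating twice: the
    first derivatives X(y_i) and (I X)(y_i) are odd and anticommute, whereas the
    F_i are even and commute, so the second order terms cancel
    ([chain_rule_bracket]).  The equations for the values of H and I H on the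
    coordinates reduce to (I X)^2 = - X^2 ([holomorphic_cJ_square]), a consequence
    of the Cauchy-Riemann equations for X in complex coordinates of M. *)

Set Implicit Arguments.
Unset Strict Implicit.
Unset Printing Implicit Defensive.

(* [cst] is the inclusion of the constants of a superspace again, and not the
   constant function. *)
Import Defs.
Import numFieldNormedType.Exports.
Import Order.TTheory GRing.Theory Num.Theory.
Local Open Scope classical_set_scope.
Local Open Scope ring_scope.

(** * Sections, restrictions and parities *)

Section Sections.
Variables (R : realType) (M : superspace R).
Implicit Types U V W : set M.

Lemma res_add U V (s t : sec M U) : open U -> open V -> V `<=` U ->
  res V (s + t) = res V s + res V t.
Proof. exact: resD. Qed.

Lemma res_mul U V (s t : sec M U) : open U -> open V -> V `<=` U ->
  res V (s * t) = res V s * res V t.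
Proof. exact: resM. Qed.

Lemma res_res U V W (s : sec M U) : open U -> open V -> open W ->
  V `<=` U -> W `<=` V -> res W (res V s) = res W s.
Proof. exact: res_comp. Qed.

Lemma res_self U (s : sec M U) : open U -> res U s = s.
Proof. exact: res_id. Qed.

Lemma res_one U V : open U -> open V -> V `<=` U -> res V (1 : sec M U) = 1.
Proof.
by move=> oU oV VU; rewrite -(rmorph1 (cst U)) /res res_cst // rmorph1.
Qed.

Lemma res_zero U V : open U -> open V -> V `<=` U -> res V (0 : sec M U) = 0.
Proof.
by move=> oU oV VU; rewrite -(rmorph0 (cst U)) /res res_cst // rmorph0.
Qed.

Lemma res_opp U V (s : sec M U) : open U -> open V -> V `<=` U ->
  res V (- s) = - res V s.
Proof.
move=> oU oV VU; apply/eqP; rewrite -addr_eq0 -res_add // addNr.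
by rewrite res_zero.
Qed.

Lemma res_sum U V (I : Type) (r : seq I) (f : I -> sec M U) :
  open U -> open V -> V `<=` U ->
  res V (\sum_(i <- r) f i) = \sum_(i <- r) res V (f i).
Proof.
move=> oU oV VU; elim: r => [|i r IHr]; first by rewrite !big_nil res_zero.
by rewrite !big_cons res_add // IHr.
Qed.

Lemma par_one U : open U -> par false (1 : sec M U).
Proof. by move=> oU; rewrite -(rmorph1 (cst U)); apply: par_cst. Qed.

Lemma par_opp U p (s : sec M U) : open U -> par p s -> par p (- s).
Proof. by move=> oU ps; rewrite -sub0r; apply: parB => //; apply: par0. Qed.

Lemma par_add U p (s t : sec M U) : open U ->
  par p s -> par p t -> par p (s + t).
Proof.
by move=> oU ps pt; rewrite -[t]opprK; apply: parB => //; apply: par_opp.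
Qed.

Lemma par_sign U p (b : bool) (s : sec M U) : open U ->
  par p s -> par p ((-1) ^+ b * s).
Proof.
by move=> oU ps; rewrite mulr_sign; case: b => //; apply: par_opp.
Qed.

Lemma cst_half U (s : sec M U) : cst U 2^-1 * (s + s) = s.
Proof.
rewrite -mulr2n -[s *+ 2]mulr_natl mulrA -(rmorph_nat (cst U)) -rmorphM /=.
by rewrite mulVf ?pnatr_eq0 // rmorph1 mul1r.
Qed.

End Sections.

(** * Vector fields *)

Section VectorFields.
Variables (R : realType) (k l m n : nat) (B : supermanifold R k l).
Variable (M : family B m n).
Implicit Types (U V A : set M) (X Y Z : op M).

Lemma op_eq_trans U X Y Z : op_eq U X Y -> op_eq U Y Z -> op_eq U X Z.
Proof. by move=> XY YZ V s oV VU; rewrite XY // YZ. Qed.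

Lemma vfield_sub p U V X : V `<=` U -> vfield p U X -> vfield p V X.
Proof.
move=> VU [Xa Xl Xp Xr Xb].
have sub A : A `<=` V -> A `<=` U by move=> AV; apply: subset_trans VU.
split=> *; [exact: Xa (sub _ _) | exact: Xl (sub _ _) _ | exact: Xp (sub _ _) _
  | exact: Xr (sub _ _) _ _ | exact: Xb (sub _ _) _ _]; auto.
Qed.

Section Rules.
Variables (p : bool) (U : set M) (X : op M).
Arguments X : clear implicits.
Hypothesis vX : vfield p U X.
Variable V : set M.
Hypotheses (oV : open V) (VU : V `<=` U).

Lemma vf_zero : X V 0 = 0.
Proof.
apply: (addrI (X V 0)); rewrite -(vf_add vX) // !addr0; exact: erefl.
Qed.

Lemma vf_opp (s : sec M V) : X V (- s) = - X V s.
Proof.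
by apply/eqP; rewrite -addr_eq0 -(vf_add vX) // addNr vf_zero.
Qed.

Lemma vf_sign (b : bool) (s : sec M V) : X V ((-1) ^+ b * s) = (-1) ^+ b * X V s.
Proof. by rewrite !mulr_sign; case: b => //; rewrite vf_opp. Qed.

Lemma vf_sum (I : Type) (r : seq I) (f : I -> sec M V) :
  X V (\sum_(i <- r) f i) = \sum_(i <- r) X V (f i).
Proof.
elim: r => [|i r IHr]; first by rewrite !big_nil vf_zero.
by rewrite !big_cons (vf_add vX) // IHr.
Qed.

Lemma vf_one : X V 1 = 0.
Proof.
have := vf_leibniz vX 1 oV VU (par_one oV).
rewrite !mulr1 andbF expr0 !mul1r => /eqP.
by rewrite -subr_eq0 opprD addNKr oppr_eq0 => /eqP.
Qed.

Lemma vf_bool (b : bool) : X V b%:R = 0.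
Proof. by case: b; rewrite ?vf_one ?vf_zero. Qed.

End Rules.

Lemma vfield_ext p U X Y : op_eq U X Y -> vfield p U X -> vfield p U Y.
Proof.
move=> XY vX; split.
- by move=> V s t oV VU; rewrite -!XY // (vf_add vX).
- by move=> V q s t oV VU qs; rewrite -!XY //; apply: (vf_leibniz vX).
- by move=> V q s oV VU qs; rewrite -!XY //; apply: (vf_par vX).
- move=> V V' s oV VU oV' VV'; rewrite -!XY //; first exact: (vf_res vX).
  exact: subset_trans VU.
- by move=> V W b oV VU oW VW; rewrite -!XY //; apply: (vf_rel vX).
Qed.

Lemma vfield0 p U : vfield p U (fun V _ => 0).
Proof.
split=> //.
- by move=> V s t _ _; rewrite addr0.
- by move=> V q s t _ _ _; rewrite mul0r !mulr0 addr0.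
- by move=> V q s oV _ _; apply: par0.
- by move=> V V' s oV VU oV' VV'; rewrite res_zero.
Qed.

Lemma vfieldD p U X Y : vfield p U X -> vfield p U Y -> vfield p U (opD X Y).
Proof.
move=> vX vY; split; rewrite /opD.
- by move=> V s t oV VU; rewrite (vf_add vX) // (vf_add vY) // addrACA.
- move=> V q s t oV VU qs; rewrite (vf_leibniz vX _ oV VU qs).
  by rewrite (vf_leibniz vY _ oV VU qs) addrACA -mulrDl -mulrDr -mulrDr.
- move=> V q s oV VU qs.
  by apply: par_add => //; [apply: (vf_par vX)|apply: (vf_par vY)].
- move=> V V' s oV VU oV' VV'.
  by rewrite (vf_res vX _ oV) // (vf_res vY _ oV) // res_add.
- by move=> V W b oV VU oW VW; rewrite (vf_rel vX) // (vf_rel vY) // addr0.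
Qed.

Lemma vfieldM p q U (f : sec M U) X : open U -> par q f -> vfield p U X ->
  vfield (q (+) p) U (opM f X).
Proof.
move=> oU qf vX.
have pfV V : open V -> V `<=` U -> par q (res V f).
  by move=> oV VU; apply: res_par.
split; rewrite /opM.
- by move=> V s t oV VU; rewrite (vf_add vX) // mulrDr.
- move=> V r s t oV VU rs; rewrite (vf_leibniz vX _ oV VU rs) mulrDr !mulrA.
  congr (_ + _); rewrite [res V f * _]commr_sign -!mulrA; move: (X V t) => u.
  rewrite (mulrA (res V f)) (supercomm oV (pfV _ oV VU) rs) !mulrA -signr_addb.
  congr (_ ^+ _ * _ * _ * _); by case: p q r {vX qf pfV rs} => [] [] [].
- move=> V r s oV VU rs; rewrite -addbA; apply: parM => //; first exact: pfV.
  exact: (vf_par vX).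
- move=> V V' s oV VU oV' VV'.
  rewrite (vf_res vX _ oV) // res_mul // res_res //.
- by move=> V W b oV VU oW VW; rewrite (vf_rel vX) // mulr0.
Qed.

Lemma opN_opM U X : open U -> op_eq U (opM (- 1 : sec M U) X) (opN X).
Proof.
by move=> oU V s oV VU; rewrite /opM /opN res_opp // res_one // mulN1r.
Qed.

Lemma opZ_opM U a X : open U -> op_eq U (opM (cst U a) X) (opZ a X).
Proof. by move=> oU V s oV VU; rewrite /opM /opZ /res res_cst. Qed.

Lemma vfieldN p U X : open U -> vfield p U X -> vfield p U (opN X).
Proof.
move=> oU vX; apply: (vfield_ext (opN_opM X oU)); rewrite -[p]addFb.
by apply: vfieldM => //; apply: par_opp => //; apply: par_one.
Qed.

Lemma vfieldZ p U a X : open U -> vfield p U X -> vfield p U (opZ a X).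
Proof.
move=> oU vX; apply: (vfield_ext (opZ_opM a X oU)); rewrite -[p]addFb.
by apply: vfieldM => //; apply: par_cst.
Qed.

Lemma vfieldB p U X Y : open U ->
  vfield p U X -> vfield p U Y -> vfield p U (opB X Y).
Proof. by move=> oU vX vY; apply: (vfieldD vX (vfieldN oU vY)). Qed.

(** The shape of the Leibniz rule for a supercommutator: [b] and [c] are the
    terms that differentiate both factors, and each order of composition
    produces them once. *)
Lemma cross_terms_cancel (G : zmodType) (x y b c u v : G) :
  x + b + (c + u) - (y + c + (b + v)) = x - y + (u - v).
Proof.
rewrite (addrACA y) opprD addrACA.
by congr (_ + _); rewrite opprD addrACA subrr ?addr0 ?add0r.
Qed.

Lemma vfield_bracket p q U X Y : vfield p U X -> vfield q U Y ->
  vfield (p (+) q) U (bracket p q X Y).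
Proof.
move=> vX vY; split; rewrite /bracket.
- move=> V s t oV VU; rewrite !(vf_add vX, vf_add vY) //.
  by rewrite mulrDr opprD addrACA.
- move=> V r s t oV VU rs.
  have pYs := vf_par vY oV VU rs; have pXs := vf_par vX oV VU rs.
  have -> : X V (Y V (s * t)) = X V (Y V s) * t
      + (-1) ^+ (p && (q (+) r)) * (Y V s * X V t)
      + ((-1) ^+ (q && r) * (X V s * Y V t)
      + (-1) ^+ ((p (+) q) && r) * (s * X V (Y V t))).
    rewrite (vf_leibniz vY _ oV VU rs) (vf_add vX) // (vf_sign vX) //.
    rewrite (vf_leibniz vX _ oV VU pYs) (vf_leibniz vX _ oV VU rs).
    rewrite mulrDr [(-1) ^+ _ * ((-1) ^+ _ * _)]mulrA -signr_addb -andb_addl.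
    by rewrite [q (+) p]addbC.
  have -> : Y V (X V (s * t)) = Y V (X V s) * t
      + (-1) ^+ (q && (p (+) r)) * (X V s * Y V t)
      + ((-1) ^+ (p && r) * (Y V s * X V t)
      + (-1) ^+ ((p (+) q) && r) * (s * Y V (X V t))).
    rewrite (vf_leibniz vX _ oV VU rs) (vf_add vY) // (vf_sign vY) //.
    rewrite (vf_leibniz vY _ oV VU pXs) (vf_leibniz vY _ oV VU rs).
    by rewrite mulrDr [(-1) ^+ _ * ((-1) ^+ _ * _)]mulrA -signr_addb -andb_addl.
  rewrite !mulrDr !(mulrA ((-1) ^+ _) ((-1) ^+ _)) -!signr_addb.
  rewrite mulrBl (mulrN s) mulrN.
  have -> : (p && q) (+) (q && (p (+) r)) = q && r.
    by case: p q r {vX vY rs pXs pYs} => [] [] [].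
  have -> : (p && q) (+) (p && r) = p && (q (+) r) by rewrite andb_addr.
  rewrite (mulrA s) (commr_sign s) -(mulrA _ s) (mulrA ((-1) ^+ _) ((-1) ^+ _)).
  rewrite -signr_addb [_ (+) (p && q)]addbC.
  rewrite (mulrA _ (Y V (X V s))); exact: cross_terms_cancel.
- move=> V r s oV VU rs; apply: parB => //.
    by rewrite -addbA; apply: (vf_par vX) => //; apply: (vf_par vY).
  apply: par_sign => //; rewrite [p (+) q]addbC -addbA.
  by apply: (vf_par vY) => //; apply: (vf_par vX).
- move=> V V' s oV VU oV' VV'.
  rewrite (vf_res vX _ oV) // (vf_res vY _ oV) // (vf_res vX _ oV) //.
  rewrite (vf_res vY _ oV) // !mulr_sign.
  by case: (p && q); rewrite !(res_add, res_opp).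
- move=> V W b oV VU oW VW; rewrite (vf_rel vX) // (vf_rel vY) //.
  by rewrite (vf_zero vX) // (vf_zero vY) // mulr0 subr0.
Qed.

(** The even square of an odd field is a vector field because it is half of a
    supercommutator. *)
Lemma half_bracket V X (s : sec M V) :
  opZ 2^-1 (bracket true true X X) s = X V (X V s).
Proof. by rewrite /opZ /bracket /= expr1 mulN1r opprK cst_half. Qed.

End VectorFields.

Arguments vfield0 {R k l m n B M} p U.

(** * Parity of the even coordinates *)

Lemma smooth_on_cst (R : realType) m (V : set 'rV[R]_m) (r : R) :
  smooth_on V (fun=> r).
Proof.
move=> q; elim: q r => [|q IHq] r; split=> //=.
- by move=> y _; apply: cst_continuous.
- by move=> y _; apply: cst_continuous.
- move=> i; split=> [y _|]; first exact: derivable_cst.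
  have -> : (fun y => 'D_(e_ i) (fun=> r) y) = (fun=> 0) :> ('rV[R]_m -> R).
    by apply/funext => y; rewrite derive_cst.
  exact: IHq.
Qed.

Lemma smooth_on_coordinate (R : realType) m (V : set 'rV[R]_m) (j : 'I_m) :
  smooth_on V (fun y => y 0 j).
Proof.
have drv (y v : 'rV[R]_m) : derivable (fun y : 'rV[R]_m => y 0 j) y v.
  exact: ((derivable_mxP id y v).1 (@derivable_id _ _ y v) 0 j).
case=> [|q]; split=> //=.
- by move=> y _; apply: coord_continuous.
- by move=> y _; apply: coord_continuous.
- move=> i; split=> [y _|]; first exact: drv.
  have -> : (fun y => 'D_(e_ i) (fun y : 'rV[R]_m => y 0 j) y)
    = (fun=> (e_ i : 'rV[R]_m) 0 j).
    apply/funext => y.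
    have := derive_mx (@derivable_id _ _ y (e_ i : 'rV[R]_m)); rewrite derive_id.
    by move=> /matrixP/(_ 0 j); rewrite [RHS]mxE => <-.
  exact: smooth_on_cst.
Qed.

Lemma par_ecrd (R : realType) (M : superspace R) m n (c : chart M m n) i :
  par false (ecrd c i).
Proof.
apply: smf_even; [exact: dom_open | by [] | exact: smooth_on_coordinate].
Qed.

(** * The complex structure *)

Section ComplexStructure.
Variables (R : realType) (k l a b : nat) (B : supermanifold R k l).
Variable (C : complex_family B a b).
Implicit Types (U V A : set C) (X Y Z : op C).

Lemma cJ_vfield p U X : open U -> vfield p U X -> vfield p U (cJ X).
Proof. exact: (ac_vf (cJ_almost_complex C)). Qed.

Lemma cJ_ext p U X Y : open U -> vfield p U X -> op_eq U X Y ->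
  op_eq U (cJ X) (cJ Y).
Proof.
move=> oU vX XY.
exact: (ac_ext (cJ_almost_complex C) oU vX (vfield_ext XY vX)).
Qed.

Lemma cJ_cJ p U X : open U -> vfield p U X -> op_eq U (cJ (cJ X)) (opN X).
Proof. exact: (ac_square (cJ_almost_complex C)). Qed.

Lemma cJ_mul p q U (f : sec C U) X : open U -> par q f -> vfield p U X ->
  op_eq U (cJ (opM f X)) (opM f (cJ X)).
Proof. exact: (ac_mul (cJ_almost_complex C)). Qed.

Lemma cJ_add p U X Y : open U -> vfield p U X -> vfield p U Y ->
  op_eq U (cJ (opD X Y)) (opD (cJ X) (cJ Y)).
Proof. exact: (ac_add (cJ_almost_complex C)). Qed.

Lemma cJ_scale p U (r : R) X : open U -> vfield p U X ->
  op_eq U (cJ (opZ r X)) (opZ r (cJ X)).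
Proof.
move=> oU vX; apply: op_eq_trans (opZ_opM r (cJ X) oU).
apply: op_eq_trans (cJ_mul oU (par_cst r oU) vX).
move=> V s oV VU; apply/esym.
exact: (cJ_ext oU (vfieldM oU (par_cst r oU) vX) (opZ_opM r X oU)).
Qed.

Lemma cJ_zero U : open U -> op_eq U (cJ (fun V (_ : sec C V) => 0)) (fun _ _ => 0).
Proof.
move=> oU V s oV VU; pose O : op C := fun V _ => 0.
have vO : vfield false U O by apply: vfield0.
have e : op_eq U (opM (0 : sec C U) O) O.
  by move=> A t oA AU; rewrite /opM mulr0.
have p0 : par false (0 : sec C U) by apply: par0.
rewrite -(cJ_ext oU (vfieldM oU p0 vO) e) // (cJ_mul oU p0 vO) //.
by rewrite /opM res_zero // mul0r.
Qed.

Section Combinations.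
Variables (I : finType) (d : I -> bool) (p : bool) (U : set C).
Variables (f : I -> sec C U) (E : I -> op C).
Hypotheses (oU : open U) (pf : forall i, par (p (+) d i) (f i)).
Hypothesis vE : forall i, vfield (d i) U (E i).

Lemma vfield_term i : vfield p U (opM (f i) (E i)).
Proof. by have := vfieldM oU (pf i) (vE i); rewrite addbK. Qed.

Lemma cJ_comb : op_eq U (cJ (op_comb f E)) (op_comb f (fun i => cJ (E i))).
Proof.
rewrite /op_comb; set r := index_enum I.
suff [] : vfield p U (fun V s => \sum_(i <- r) opM (f i) (E i) V s) /\
  op_eq U (cJ (fun V s => \sum_(i <- r) opM (f i) (E i) V s))
    (fun V s => \sum_(i <- r) opM (f i) (cJ (E i)) V s) by [].
elim: r => [|i r [vr IHr]].
  have e0 : op_eq U (fun V _ => 0)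
      (fun V s => \sum_(i <- [::]) opM (f i) (E i) V s).
    by move=> V s _ _; rewrite big_nil.
  split; first by apply: vfield_ext e0 (vfield0 _ _).
  move=> V s oV VU; rewrite big_nil -(cJ_ext oU (vfield0 p U) e0) //.
  exact: cJ_zero oU _ _ oV VU.
have e1 : op_eq U (opD (opM (f i) (E i))
    (fun V s => \sum_(i <- r) opM (f i) (E i) V s))
    (fun V s => \sum_(i <- i :: r) opM (f i) (E i) V s).
  by move=> V s _ _; rewrite big_cons.
have v1 := vfieldD (vfield_term i) vr.
split; first exact: vfield_ext e1 v1.
move=> V s oV VU; rewrite big_cons -(cJ_ext oU v1 e1) //.
rewrite (cJ_add oU (vfield_term i) vr) // /opD IHr //.
by rewrite (cJ_mul oU (pf i) (vE i)).
Qed.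

End Combinations.

Lemma cJ_comb_of (I : finType) (d : I -> bool) p U X (f : I -> sec C U)
    (E : I -> op C) : open U -> (forall i, par (p (+) d i) (f i)) ->
  (forall i, vfield (d i) U (E i)) -> vfield p U X -> op_eq U X (op_comb f E) ->
  op_eq U (cJ X) (op_comb f (fun i => cJ (E i))).
Proof.
move=> oU pf vE vX XE.
exact: op_eq_trans (cJ_ext oU vX XE) (cJ_comb oU pf vE).
Qed.

End ComplexStructure.

(** * Complex coordinates *)

Section ConjugateIndex.
Variables a b : nat.
Implicit Type i : 'I_(a + a) + 'I_(b + b).

Definition odd_index i : bool := if i is inr _ then true else false.

Definition imaginary i : bool :=
  match i with
  | inl x => if fintype.split x is inr _ then true else false
  | inr y => if fintype.split y is inr _ then true else false
  end.

Definition swap_re_im i : 'I_(a + a) + 'I_(b + b) :=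
  match i with
  | inl x => inl match fintype.split x with inl u => rshift a u | inr u => lshift a u end
  | inr y => inr match fintype.split y with inl u => rshift b u | inr u => lshift b u end
  end.

Lemma split_lshift (c : nat) (u : 'I_c) : fintype.split (lshift c u) = inl u.
Proof. exact: (unsplitK (inl u)). Qed.

Lemma split_rshift (c : nat) (u : 'I_c) : fintype.split (rshift c u) = inr u.
Proof. exact: (unsplitK (inr u)). Qed.

Lemma swap_re_im_re (u : 'I_a + 'I_b) : swap_re_im (re_index u) = im_index u.
Proof. by case: u => u; rewrite /= split_lshift. Qed.

Lemma swap_re_im_im (u : 'I_a + 'I_b) : swap_re_im (im_index u) = re_index u.
Proof. by case: u => u; rewrite /= split_rshift. Qed.

Lemma imaginary_re (u : 'I_a + 'I_b) : imaginary (re_index u) = false.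
Proof. by case: u => u; rewrite /= split_lshift. Qed.

Lemma imaginary_im (u : 'I_a + 'I_b) : imaginary (im_index u) = true.
Proof. by case: u => u; rewrite /= split_rshift. Qed.

Lemma re_or_im i : exists u, i = re_index u \/ i = im_index u.
Proof.
case: i => x; rewrite -(splitK x); case: (fintype.split x) => u /=.
- by exists (inl u); left.
- by exists (inl u); right.
- by exists (inr u); left.
- by exists (inr u); right.
Qed.

Lemma swap_re_imK : involutive swap_re_im.
Proof.
by move=> i; have [u [->|->]] := re_or_im i; rewrite !(swap_re_im_re, swap_re_im_im).
Qed.

Lemma imaginary_swap i : imaginary (swap_re_im i) = ~~ imaginary i.
Proof.
by have [u [->|->]] := re_or_im i;
  rewrite !(swap_re_im_re, swap_re_im_im, imaginary_re, imaginary_im).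
Qed.

End ConjugateIndex.

Section ComplexFrame.
Variables (R : realType) (k l a b : nat) (B : supermanifold R k l).
Variable (C : complex_family B a b).
Implicit Types (U V A : set C) (X Y Z : op C).

Definition complex_frame (c : rel_chart (proj C))
    (E : 'I_(a + a) + 'I_(b + b) -> op C) : Prop :=
  coordinate_frame c E /\
  forall i, op_eq (dom c) (cJ (E (re_index i))) (E (im_index i)).

Variables (c : rel_chart (proj C)) (E : 'I_(a + a) + 'I_(b + b) -> op C).
Arguments E : clear implicits.
Hypothesis cE : complex_frame c E.
Local Notation x_ V i := (res V (rcrd c i)).

Lemma frame_vfield i : vfield (odd_index i) (dom c) (E i).
Proof. by have [[[vE _ _] _] _] := cE; apply: vE. Qed.

Lemma frame_dual V i j : open V -> V `<=` dom c ->
  E i V (x_ V j) = (i == j)%:R.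
Proof.
move=> oV Vc; have [[_ dE] _] := cE.
rewrite (vf_res (frame_vfield i) _ (dom_open c)) // dE; case: (i == j).
  by rewrite res_one //; apply: dom_open.
by rewrite res_zero //; apply: dom_open.
Qed.

Lemma cJ_frame i :
  op_eq (dom c) (cJ (E i)) (fun V s => (-1) ^+ imaginary i * E (swap_re_im i) V s).
Proof.
have [_ JE] := cE; have [u [->|->]] := re_or_im i => V s oV Vc.
  by rewrite imaginary_re swap_re_im_re mul1r JE.
rewrite imaginary_im swap_re_im_im mulN1r.
have od := dom_open c; have ve := frame_vfield (re_index u).
rewrite -(cJ_ext od (cJ_vfield od ve) (JE u)) //.
by rewrite (cJ_cJ od ve).
Qed.

(** The frame is dual to the coordinates, so evaluating any expansion of [Z] on
    the coordinates recovers its coefficients; [cJ] then acts on the frame. *)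
Lemma vfield_expansion p V Z : open V -> V `<=` dom c -> vfield p V Z ->
  (forall s, Z V s = \sum_i Z V (x_ V i) * E i V s) /\
  (forall s, cJ Z V s =
    \sum_i Z V (x_ V i) * ((-1) ^+ imaginary i * E (swap_re_im i) V s)).
Proof.
move=> oV Vc vZ; have [[[_ span _] _] _] := cE.
have [f [pf Zf]] := span V p Z oV Vc vZ.
have vE i : vfield (odd_index i) V (E i) by apply: vfield_sub (frame_vfield i).
have fE i : f i = Z V (x_ V i).
  rewrite Zf // /op_comb (bigD1 i) //= /opM res_self // frame_dual // eqxx mulr1.
  rewrite big1 ?addr0 // => j /negPf ji.
  by rewrite frame_dual // ji mulr0.
split=> s.
  by rewrite Zf //; apply: eq_bigr => i _; rewrite /opM res_self // fE.
rewrite (cJ_comb_of oV pf vE vZ Zf) //; apply: eq_bigr => i _.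
by rewrite /opM res_self // fE cJ_frame.
Qed.

(** The transpose of [cJ_frame]: (I Z) x = - Z y and (I Z) y = Z x for a complex
    coordinate x + iy. *)
Lemma cJ_coordinate p V Z j : open V -> V `<=` dom c -> vfield p V Z ->
  cJ Z V (x_ V j) = - ((-1) ^+ imaginary j * Z V (x_ V (swap_re_im j))).
Proof.
move=> oV Vc vZ; have [_ ->] := vfield_expansion oV Vc vZ.
rewrite (bigD1 (swap_re_im j)) //= swap_re_imK frame_dual // eqxx mulr1.
rewrite big1 ?addr0 => [|i ij]; last first.
  rewrite frame_dual // (can2_eq (@swap_re_imK _ _) (@swap_re_imK _ _)).
  by rewrite (negPf ij) !mulr0.
by rewrite imaginary_swap commr_sign signrN mulNr.
Qed.

Lemma vfield_eq p V Z Z' s : open V -> V `<=` dom c -> vfield p V Z ->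
  vfield p V Z' -> (forall i, Z V (x_ V i) = Z' V (x_ V i)) -> Z V s = Z' V s.
Proof.
move=> oV Vc vZ vZ' ZZ'.
have [-> _] := vfield_expansion oV Vc vZ.
have [-> _] := vfield_expansion oV Vc vZ'.
by apply: eq_bigr => i _; rewrite ZZ'.
Qed.

(** The commutator annihilates the coordinates, since the coordinates have
    constant derivatives along the frame; hence it vanishes. *)
Lemma frame_commute V i j s : open V -> V `<=` dom c ->
  odd_index i = false -> odd_index j = false ->
  E i V (E j V s) = E j V (E i V s).
Proof.
move=> oV Vc ei ej.
have vi : vfield false V (E i).
  by rewrite -ei; apply: vfield_sub (frame_vfield i).
have vj : vfield false V (E j).
  by rewrite -ej; apply: vfield_sub (frame_vfield j).
have := vfield_eq s oV Vc (vfield_bracket vi vj) (vfield0 _ _).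
rewrite /bracket /= expr0 mul1r => eq0.
apply/eqP; rewrite -subr_eq0; apply/eqP; apply: eq0 => h.
by rewrite !frame_dual // (vf_bool vi) // (vf_bool vj) // mul1r subr0.
Qed.

(** The components of a holomorphic field satisfy the Cauchy-Riemann equations,
    which turn a derivative along I X into one along X.  Both sides are even
    vector fields, halves of [I X, I X] and of - [X, X], so that they may be
    compared on the coordinates.  The integrability of the complex structure is
    essential: holomorphy of X alone does not determine [I X, I X]. *)
Lemma holomorphic_cJ_square V X s : open V -> V `<=` dom c ->
  holomorphic_field true V X -> cJ X V (cJ X V s) = - X V (X V s).
Proof.
move=> oV Vc [vX hX]; have vJX := cJ_vfield oV vX.
have vE i : vfield (odd_index i) V (E i) by apply: vfield_sub (frame_vfield i).
pose u j := X V (x_ V j).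
have Ju j : cJ X V (x_ V j) = - ((-1) ^+ imaginary j * u (swap_re_im j)).
  exact: cJ_coordinate vX.
have CR i j : (-1) ^+ imaginary i * E (swap_re_im i) V (u (swap_re_im j))
    = (-1) ^+ imaginary j * E i V (u j).
  (* [X, I E_i] = I [X, E_i], evaluated on the other part of the coordinate j. *)
  have vb := vfield_bracket vX (vE i).
  have := hX V _ (E i) oV (fun x Vx => Vx) (vE i).
  move=> /(_ V (x_ V (swap_re_im j)) oV (fun x Vx => Vx)).
  rewrite (cJ_coordinate _ _ _ vb) // imaginary_swap swap_re_imK signrN.
  rewrite /bracket !cJ_frame // !frame_dual // (vf_sign vX) // !(vf_bool vX) //.
  rewrite mulr0 !sub0r mulNr opprK mulrN => /oppr_inj.
  rewrite ![(-1) ^+ _ * ((-1) ^+ (_ && _) * _)]mulrA.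
  rewrite ![(-1) ^+ _ * (-1) ^+ (_ && _)]commr_sign -!mulrA.
  exact: (can_inj (signrMK _)).
have square_vfield Y : vfield true V Y ->
    vfield false V (opZ 2^-1 (bracket true true Y Y)).
  by move=> vY; apply: vfieldZ => //; apply: (vfield_bracket vY vY).
rewrite -!half_bracket.
apply: (vfield_eq _ oV Vc (square_vfield _ vJX) (vfieldN oV (square_vfield _ vX))).
move=> j; rewrite /opN !half_bracket Ju (vf_opp vJX) // (vf_sign vJX) //.
congr (- _); have [_ ->] := vfield_expansion oV Vc vX.
under eq_bigr do rewrite CR mulrA [_ * (-1) ^+ _]commr_sign -mulrA.
rewrite -big_distrr /= signrMK.
by have [<- _] := vfield_expansion oV Vc vX.
Qed.

End ComplexFrame.

(** * Pulling functions back *)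

Section PullBack.
Variables (R : realType) (M N : superspace R) (phi : morphism M N).
Implicit Types (A U : set M) (V W : set N).

Definition pull_on A V (f : sec N V) : sec M A := res A (pull phi f).

Lemma open_preimage V : open V -> open (phi @^-1` V).
Proof. by move/continuousP: (@base_map_continuous _ _ _ phi); apply. Qed.

Lemma open_setI_preimage A V : open A -> open V -> open (A `&` phi @^-1` V).
Proof. by move=> oA oV; apply: openI => //; apply: open_preimage. Qed.

Section Rules.
Variables (A : set M) (V : set N).
Hypotheses (oA : open A) (oV : open V) (AV : A `<=` phi @^-1` V).
Let oP := open_preimage oV.

Lemma pull_on_mul (f g : sec N V) :
  pull_on A (f * g) = pull_on A f * pull_on A g.
Proof. by rewrite /pull_on pullM // res_mul. Qed.

Lemma pull_on_add (f g : sec N V) :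
  pull_on A (f + g) = pull_on A f + pull_on A g.
Proof. by rewrite /pull_on pullD // res_add. Qed.

Lemma pull_on_cst (r : R) : pull_on A (cst V r) = cst A r.
Proof. by rewrite /pull_on pull_cst // /res res_cst. Qed.

Lemma pull_on_bool (b : bool) : pull_on A (b%:R : sec N V) = b%:R.
Proof.
rewrite -(rmorph_nat (cst V)) pull_on_cst; exact: rmorph_nat.
Qed.

Lemma pull_on_opp (f : sec N V) : pull_on A (- f) = - pull_on A f.
Proof.
apply/eqP; rewrite -addr_eq0 -pull_on_add addNr.
by rewrite (pull_on_bool false).
Qed.

Lemma pull_on_sign (b : bool) (f : sec N V) :
  pull_on A ((-1) ^+ b * f) = (-1) ^+ b * pull_on A f.
Proof. by rewrite !mulr_sign; case: b => //; apply: pull_on_opp. Qed.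

Lemma pull_on_sum (I : Type) (r : seq I) (f : I -> sec N V) :
  pull_on A (\sum_(i <- r) f i) = \sum_(i <- r) pull_on A (f i).
Proof.
elim: r => [|i r IHr]; first by rewrite !big_nil (pull_on_bool false).
by rewrite !big_cons pull_on_add IHr.
Qed.

Lemma par_pull_on p (f : sec N V) : par p f -> par p (pull_on A f).
Proof. by move=> pf; apply: res_par => //; apply: pull_par. Qed.

Lemma res_pull_on A' (f : sec N V) : open A' -> A' `<=` A ->
  res A' (pull_on A f) = pull_on A' f.
Proof. by move=> oA' A'A; rewrite /pull_on res_res. Qed.

Lemma pull_on_res W (f : sec N W) : open W -> V `<=` W ->
  pull_on A (res V f) = pull_on A f.
Proof.
move=> oW VW; rewrite /pull_on pull_res // res_res //.
  exact: open_preimage.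
by move=> x; apply: VW.
Qed.

End Rules.
End PullBack.

(** * The chain rule along a map and complex linearity *)

Section ChainRule.
Variables (R : realType) (k l m n a : nat) (B : supermanifold R k l).
Variables (M : family B m n) (N : complex_family B a 0) (phi : morphism M N).
Implicit Types (A U : set M) (V W : set N) (X Y Z : op M).

Variables (c : rel_chart (proj N)) (F : 'I_(a + a) + 'I_(0 + 0) -> op N).
Arguments F : clear implicits.
Hypothesis cF : complex_frame c F.
Let oc := dom_open c.

Lemma even_index (i : 'I_(a + a) + 'I_(0 + 0)) : odd_index i = false.
Proof. by case: i => // -[]. Qed.

Definition coord_on A i : sec M A := pull_on phi A (rcrd c i).
Local Notation t_ := coord_on.

Lemma par_coord_on A i : open A -> A `<=` phi @^-1` dom c -> par false (t_ A i).
Proof.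
move=> oA Ac; apply: par_pull_on => //; case: i => [i|[]//].
exact: par_ecrd.
Qed.

(** The derivation [Z] o phi^# along [phi] is a combination of the coordinate
    fields of the target, that is, a section of phi^*TN = O_M (x) phi^{-1} TN. *)
Definition chain_rule U Z : Prop := forall A V (f : sec N V),
  open A -> A `<=` U -> open V -> V `<=` dom c -> A `<=` phi @^-1` V ->
  Z A (pull_on phi A f) =
    \sum_i Z A (t_ A i) * pull_on phi A (F i V f).

(** d phi [Z'] = J d phi [Z] in the coordinates of the target. *)
Definition complex_related U Z Z' : Prop :=
  [/\ chain_rule U Z, chain_rule U Z' &
      forall A i, open A -> A `<=` U ->
        Z' A (t_ A i) = - ((-1) ^+ imaginary i * Z A (t_ A (swap_re_im i)))].

(** A section sum_i h_i (x) Y_i of phi^*TN can be rewritten by expanding the Y_i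
    in the coordinate frame; evaluation on the coordinates identifies the
    resulting coefficients, and those of its image under J are the same up to
    exchanging real and imaginary parts. *)
Lemma is_J_complex_related p p' U Z Z' (w : along phi U) x :
  open U -> vfield p U Z -> vfield p' U Z' ->
  is_J (differential phi U Z) w ->
  (forall V (f : sec N V), open V -> w V f = differential phi U Z' V f) ->
  U x -> dom c (phi x) ->
  exists U1, [/\ open U1, U1 x, U1 `<=` U, U1 `<=` phi @^-1` dom c &
                 complex_related U1 Z Z'].
Proof.
move=> oU vZ vZ' JZ wZ' Ux cx.
have [U' [W [r [h [d [Y [[oU' oW] U'x U'U U'W [vY hY]]]]]]]] := JZ x Ux.
pose W1 := W `&` dom c; have oW1 : open W1 by apply: openI.
have W1W : W1 `<=` W by move=> y [].
have W1c : W1 `<=` dom c by move=> y [].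
pose U1 := U' `&` phi @^-1` W1.
have vY1 i : vfield (d i) W1 (Y i) by apply: vfield_sub (vY i).
(* The coefficients of Y_i in the frame, and those of the whole section. *)
pose q i A j : sec M A := pull_on phi A (Y i W1 (res W1 (rcrd c j))).
pose g A j : sec M A := \sum_i res A (h i) * q i A j.
have main A V (f : sec N V) : open A -> A `<=` U1 -> open V -> V `<=` dom c ->
    A `<=` phi @^-1` V ->
    Z A (pull_on phi A f) = \sum_j g A j * pull_on phi A (F j V f) /\
    Z' A (pull_on phi A f) = \sum_j g A j *
       ((-1) ^+ imaginary j * pull_on phi A (F (swap_re_im j) V f)).
  move=> oA AU1 oV Vc AV.
  pose V1 := V `&` W1; have oV1 : open V1 by apply: openI.
  have V1W1 : V1 `<=` W1 by move=> y [].
  have V1V : V1 `<=` V by move=> y [].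
  have V1c : V1 `<=` dom c by move=> y [/Vc].
  have AV1 : A `<=` phi @^-1` V1.
    by move=> y Ay; split; [exact: AV | exact: (AU1 _ Ay).2].
  have AU : A `<=` U by move=> y /AU1[/U'U].
  have oD : open (U `&` phi @^-1` V1) by apply: open_setI_preimage.
  have oD' : open (U' `&` phi @^-1` V1) by apply: open_setI_preimage.
  have D'D : U' `&` phi @^-1` V1 `<=` U `&` phi @^-1` V1.
    by move=> y [/U'U].
  have AD' : A `<=` U' `&` phi @^-1` V1.
    by move=> y Ay; split; [exact: (AU1 _ Ay).1 | exact: AV1].
  have DV1 : U `&` phi @^-1` V1 `<=` phi @^-1` V1 by move=> y [].
  (* The operators are compared on the smaller open set V1, where both the Y_i
     and the frame are defined. *)
  have diffE q0 X : vfield q0 U X ->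
      res A (res (U' `&` phi @^-1` V1) (differential phi U X V1 (res V1 f)))
      = X A (pull_on phi A f).
    move=> vX; rewrite /differential -/(pull_on _ _ _).
    rewrite res_res // -(vf_res vX) //; last by apply: subset_trans D'D.
    by rewrite res_pull_on //; [rewrite pull_on_res | apply: subset_trans D'D].
  have termE (X : op N) i : res A (res (U' `&` phi @^-1` V1) (h i) *
      res (U' `&` phi @^-1` V1) (pull phi (X V1 (res V1 f))))
      = res A (h i) * pull_on phi A (X V1 (res V1 f)).
    by rewrite res_mul // !res_res //; [apply: open_preimage | move=> y []..].
  have [eZ eZ'] := hY V1 (res V1 f) oV1 (subset_trans V1W1 W1W).
  rewrite -(diffE _ _ vZ) -(diffE _ _ vZ') -wZ' // eZ eZ' !res_sum //.
  have qE i j : pull_on phi A (Y i V1 (res V1 (rcrd c j))) = q i A j.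
    rewrite /q -(res_res _ oc oW1 oV1) // (vf_res (vY1 i)) //.
    by rewrite pull_on_res.
  have FE j : pull_on phi A (F j V1 (res V1 f)) = pull_on phi A (F j V f).
    by rewrite (vf_res (frame_vfield cF j)) // pull_on_res.
  have vYV i : vfield (d i) V1 (Y i) by apply: vfield_sub (vY1 i).
  split.
    under eq_bigr => i _.
      rewrite termE (vfield_expansion cF oV1 V1c (vYV i)).1 pull_on_sum //.
      under eq_bigr => j _ do rewrite pull_on_mul // qE FE.
      rewrite big_distrr /=; over.
    rewrite exchange_big /=; apply: eq_bigr => j _.
    by rewrite big_distrl /=; apply: eq_bigr => i _; rewrite mulrA.
  under eq_bigr => i _.
    rewrite termE (vfield_expansion cF oV1 V1c (vYV i)).2 pull_on_sum //.
    under eq_bigr => j _ do rewrite pull_on_mul // pull_on_sign // qE FE.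
    rewrite big_distrr /=; over.
  rewrite exchange_big /=; apply: eq_bigr => j _.
  by rewrite big_distrl /=; apply: eq_bigr => i _; rewrite mulrA.
have oU1 : open U1 by apply: open_setI_preimage.
have U1c : U1 `<=` phi @^-1` dom c by move=> y [_ []].
have U1x : U1 x by split=> //; split => //; apply: U'W.
have tc A i : open A -> A `<=` U1 -> Z A (t_ A i) = g A i /\
    Z' A (t_ A i) = - ((-1) ^+ imaginary i * g A (swap_re_im i)).
  move=> oA AU1; have Ac := subset_trans AU1 U1c.
  have dual j : pull_on phi A (F j _ (rcrd c i)) = (j == i)%:R.
    have := frame_dual cF j i oc (fun y cy => cy); rewrite res_self // => ->.
    exact: pull_on_bool.
  have [-> ->] := main A _ (rcrd c i) oA AU1 oc (fun y cy => cy) Ac.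
  split.
    rewrite (bigD1 i) //= dual eqxx mulr1 big1 ?addr0 // => j /negPf ji.
    by rewrite dual ji mulr0.
  rewrite (bigD1 (swap_re_im i)) //= dual swap_re_imK eqxx mulr1.
  rewrite big1 ?addr0 => [|j]; last first.
    rewrite dual (can2_eq (@swap_re_imK _ _) (@swap_re_imK _ _)).
    by move=> /negPf ->; rewrite !mulr0.
  by rewrite imaginary_swap commr_sign signrN mulNr.
exists U1; split=> //; first by move=> y [/U'U].
split.
- move=> A V f oA AU1 oV Vc AV; have [-> _] := main A V f oA AU1 oV Vc AV.
  by apply: eq_bigr => j _; have [->] := tc A j oA AU1.
- move=> A V f oA AU1 oV Vc AV; have [_ ->] := main A V f oA AU1 oV Vc AV.
  rewrite (reindex_inj (can_inj (@swap_re_imK _ _))) /=; apply: eq_bigr => j _.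
  have [_ ->] := tc A j oA AU1.
  by rewrite swap_re_imK imaginary_swap signrN mulNr mulrN mulrA commr_sign mulNr.
- move=> A i oA AU1; have [_ ->] := tc A i oA AU1.
  by have [-> _] := tc A (swap_re_im i) oA AU1.
Qed.

Lemma chain_rule_ext U Z Z' : op_eq U Z Z' -> chain_rule U Z -> chain_rule U Z'.
Proof.
move=> ZZ' cZ A V f oA AU oV Vc AV; rewrite -ZZ' // (cZ A V f) //.
by apply: eq_bigr => i _; rewrite ZZ'.
Qed.

Lemma chain_ruleM U (h : sec M U) Z : chain_rule U Z -> chain_rule U (opM h Z).
Proof.
move=> cZ A V f oA AU oV Vc AV; rewrite /opM (cZ A V f) // big_distrr /=.
by apply: eq_bigr => i _; rewrite mulrA.
Qed.

Lemma chain_ruleD U Z Z' : chain_rule U Z -> chain_rule U Z' ->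
  chain_rule U (opD Z Z').
Proof.
move=> cZ cZ' A V f oA AU oV Vc AV; rewrite /opD (cZ A V f) // (cZ' A V f) //.
by rewrite -big_split /=; apply: eq_bigr => i _; rewrite mulrDl.
Qed.

Lemma related_ext U Z1 Z1' Z2 Z2' : op_eq U Z1 Z1' -> op_eq U Z2 Z2' ->
  complex_related U Z1 Z2 -> complex_related U Z1' Z2'.
Proof.
move=> e1 e2 [c1 c2 r12]; split; try exact: chain_rule_ext c1.
  exact: chain_rule_ext c2.
by move=> A i oA AU; rewrite -e1 // -e2 // r12.
Qed.

Lemma related_sub U U' Z Z' : U' `<=` U -> complex_related U Z Z' ->
  complex_related U' Z Z'.
Proof.
move=> U'U [cZ cZ' r].
have sub A : A `<=` U' -> A `<=` U by move=> AU'; apply: subset_trans U'U.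
split=> [A V f oA AU' | A V f oA AU' | A i oA AU'].
- by apply: cZ => //; apply: sub.
- by apply: cZ' => //; apply: sub.
- by apply: r => //; apply: sub.
Qed.

Lemma relatedM U (h : sec M U) Z Z' : complex_related U Z Z' ->
  complex_related U (opM h Z) (opM h Z').
Proof.
move=> [cZ cZ' r]; split; try exact: chain_ruleM.
by move=> A i oA AU; rewrite /opM r // mulrN !mulrA commr_sign.
Qed.

Lemma relatedD U Z1 Z1' Z2 Z2' :
  complex_related U Z1 Z1' -> complex_related U Z2 Z2' ->
  complex_related U (opD Z1 Z2) (opD Z1' Z2').
Proof.
move=> [c1 c1' r1] [c2 c2' r2]; split; try exact: chain_ruleD.
by move=> A i oA AU; rewrite /opD r1 // r2 // mulrDr opprD.
Qed.

(** Applying J to w = J v gives J w = - v. *)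
Lemma related_rotate U Z Z' : open U ->
  complex_related U Z Z' -> complex_related U Z' (opN Z).
Proof.
move=> oU [cZ cZ' r]; split=> //.
  exact: chain_rule_ext (opN_opM Z oU) (chain_ruleM _ cZ).
move=> A i oA AU; rewrite /opN r // swap_re_imK imaginary_swap signrN.
by rewrite mulNr opprK signrMK.
Qed.

(** Second derivatives of a composite contribute products of two first
    derivatives: for odd fields these anticommute, while the coordinate fields
    of the even target commute, so that they cancel in the supercommutator. *)
Lemma chain_rule_bracket U Z Z' : U `<=` phi @^-1` dom c ->
  vfield true U Z -> vfield true U Z' -> chain_rule U Z -> chain_rule U Z' ->
  chain_rule U (bracket true true Z Z').
Proof.
move=> Uc vZ vZ' cZ cZ' A V f oA AU oV Vc AV.
have Ac := subset_trans AU Uc.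
(* The pulled-back second derivatives; symmetric since the frame commutes. *)
pose P i j := pull_on phi A (F j V (F i V f)).
have PC i j : P i j = P j i.
  by rewrite /P (frame_commute cF) // even_index.
have second X Y : vfield true U X -> vfield true U Y ->
    chain_rule U X -> chain_rule U Y ->
    X A (Y A (pull_on phi A f))
    = \sum_i X A (Y A (t_ A i)) * pull_on phi A (F i V f)
    - \sum_i \sum_j Y A (t_ A i) * X A (t_ A j) * P i j.
  move=> vX vY cX cY; rewrite (cY A V f) // (vf_sum vX) //.
  rewrite -sumrB; apply: eq_bigr => i _.
  have py := vf_par vY oA AU (par_coord_on i oA Ac).
  rewrite (vf_leibniz vX _ oA AU py) (cX A V) // mulN1r; congr (_ - _).
  by rewrite big_distrr /=; apply: eq_bigr => j _; rewrite mulrA.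
have anti : \sum_i \sum_j Z' A (t_ A i) * Z A (t_ A j) * P i j
    = - \sum_i \sum_j Z A (t_ A i) * Z' A (t_ A j) * P i j.
  rewrite exchange_big /= -sumrN; apply: eq_bigr => i _.
  rewrite -sumrN; apply: eq_bigr => j _.
  have p1 := vf_par vZ' oA AU (par_coord_on j oA Ac).
  have p2 := vf_par vZ oA AU (par_coord_on i oA Ac).
  by rewrite (supercomm oA p1 p2) /= expr1 mulN1r mulNr PC.
rewrite /bracket /= expr1 mulN1r opprK.
rewrite (second Z Z') // (second Z' Z) // anti opprK addrACA subrr addr0.
by rewrite -big_split /=; apply: eq_bigr => i _; rewrite -mulrDl ?expr1 mulN1r opprK.
Qed.

(** With [Z'] = I Z, the operators compared here are Z^2 and (1/2) [Z, I Z].  On a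
    coordinate each of the two terms of [Z, I Z] is, up to sign, Z^2 or (I Z)^2 of
    the other real or imaginary part, and the two contributions agree by the last
    hypothesis. *)
Lemma related_square U Z Z' : open U -> U `<=` phi @^-1` dom c ->
  vfield true U Z -> vfield true U Z' -> complex_related U Z Z' ->
  (forall A s, open A -> A `<=` U -> Z' A (Z' A s) = - Z A (Z A s)) ->
  complex_related U (opZ 2^-1 (bracket true true Z Z))
    (opZ 2^-1 (bracket true true Z Z')).
Proof.
move=> oU Uc vZ vZ' [cZ cZ' r] sq; split.
- apply: chain_rule_ext (opZ_opM _ _ oU) _; apply: chain_ruleM.
  exact: chain_rule_bracket.
- apply: chain_rule_ext (opZ_opM _ _ oU) _; apply: chain_ruleM.
  exact: chain_rule_bracket.
- move=> A i oA AU; rewrite half_bracket.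
  have Zt : Z A (t_ A i) = (-1) ^+ imaginary i * Z' A (t_ A (swap_re_im i)).
    by rewrite r // swap_re_imK imaginary_swap signrN mulNr opprK signrMK.
  rewrite /opZ /bracket /= expr1 mulN1r opprK Zt r // (vf_opp vZ) //.
  by rewrite (vf_sign vZ) // (vf_sign vZ') // sq // mulrN cst_half.
Qed.

End ChainRule.

(** By the chain rule sum_i Z(y_i) (x) F_i, with y_i the pulled-back coordinates
    and F_i the coordinate fields, is the presentation of d phi [Z] required by
    [is_J]. *)
Lemma is_J_differential (R : realType) (k l m n a : nat)
    (B : supermanifold R k l) (M : family B m n) (N : complex_family B a 0)
    (phi : morphism M N) p p' (U : set M) (Z Z' : op M) :
  open U -> vfield p U Z -> vfield p' U Z' ->
  (forall x, U x -> exists (U1 : set M) c F,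
     [/\ open U1, U1 x, U1 `<=` U, complex_frame c F &
         U1 `<=` phi @^-1` dom c /\ complex_related phi c F U1 Z Z']) ->
  is_J (differential phi U Z) (differential phi U Z').
Proof.
move=> oU vZ vZ' loc x /loc[U1 [c [F [oU1 U1x U1U cF [U1c [cZ cZ' r]]]]]].
pose ev := @enum_val _ (predT : pred ('I_(a + a) + 'I_(0 + 0))).
exists U1, (dom c), _, (fun i => Z U1 (coord_on phi c U1 (ev i))),
  (fun i => odd_index (ev i)), (fun i => F (ev i)).
have oc := dom_open c.
split=> //; split=> [i|V f oV Vc A]; first exact: frame_vfield cF _.
have oD : open (U `&` phi @^-1` V) by apply: open_setI_preimage.
have oA : open A by apply: open_setI_preimage.
have AU1 : A `<=` U1 by move=> y [].
have AD : A `<=` U `&` phi @^-1` V by move=> y [/U1U].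
have DU : U `&` phi @^-1` V `<=` U by move=> y [].
have DV : U `&` phi @^-1` V `<=` phi @^-1` V by move=> y [].
have AV : A `<=` phi @^-1` V by move=> y [].
have AU : A `<=` U by move=> y /AU1/U1U.
have diffE q X : vfield q U X ->
    res A (differential phi U X V f) = X A (pull_on phi A f).
  move=> vX; rewrite /differential -/(pull_on _ _ _).
  by rewrite -(vf_res vX) // res_pull_on.
have tE i : res A (Z U1 (coord_on phi c U1 i)) = Z A (coord_on phi c A i).
  by rewrite -(vf_res vZ) // /coord_on res_pull_on.
rewrite (diffE _ _ vZ) (diffE _ _ vZ') (cZ A V f) // (cZ' A V f) //.
have sum_ev (G : 'I_(a + a) + 'I_(0 + 0) -> sec M A) :
    \sum_i G (ev i) = \sum_i G i.
  by rewrite -big_enum_val.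
split.
  by rewrite -sum_ev; apply: eq_bigr => i _; rewrite tE.
(* I permutes the frame, so the sum is matched after exchanging real and
   imaginary parts. *)
rewrite (reindex_inj (can_inj (@swap_re_imK _ _))) -sum_ev /=.
apply: eq_bigr => i _; rewrite tE -/(pull_on _ _ _) (cJ_frame cF _ _ oV Vc).
rewrite pull_on_sign // r // swap_re_imK imaginary_swap signrN.
by rewrite mulNr opprK mulrA commr_sign.
Qed.

(** * Complex linearity of the differential on a super Riemann surface *)

Section ComplexMultiples.
Variables (R : realType) (k l a b : nat) (B : supermanifold R k l).
Variable (M : complex_family B a b).
Implicit Types (U : set M) (Z : op M).

Lemma vfield_cmul q r U (f g : sec M U) Z : open U -> par q f -> par q g ->
  vfield r U Z -> vfield (q (+) r) U (cmul f g Z).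
Proof.
move=> oU pf pg vZ; apply: vfieldD; apply: vfieldM => //.
exact: cJ_vfield.
Qed.

(** Complex linearity at Z implies complex linearity at (f + ig) Z, because it
    holds at I Z as well. *)
Lemma related_cmul (n : nat) (N : complex_family B n 0) (phi : morphism M N)
    (c : rel_chart (proj N)) F q r U (f g : sec M U) Z :
  open U -> par q f -> par q g -> vfield r U Z ->
  complex_related phi c F U Z (cJ Z) ->
  complex_related phi c F U (cmul f g Z) (cJ (cmul f g Z)).
Proof.
move=> oU pf pg vZ rZ; have vJZ := cJ_vfield oU vZ.
have rJZ : complex_related phi c F U (cJ Z) (cJ (cJ Z)).
  apply: related_ext (related_rotate oU rZ) => // V s oV VU.
  by rewrite (cJ_cJ oU vZ).
apply: related_ext (relatedD (relatedM f rZ) (relatedM g rJZ)) => // V s oV VU.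
have vf := vfieldM oU pf vZ; have vg := vfieldM oU pg vJZ.
by rewrite (cJ_add oU vf vg) // /opD (cJ_mul oU pf vZ) // (cJ_mul oU pg vJZ).
Qed.

End ComplexMultiples.

Lemma generator_section (R : realType) (k l : nat) (B : supermanifold R k l)
    (M : complex_family B 1 1) (D : forall U : set M, set (op M)) U X :
  open U -> odd_generator D U X -> D U X.
Proof.
move=> oU gX; have [vX _ _] := gX.
apply/(gen_span gX oU (fun x Ux => Ux) vX); exists 1, 0; split.
- exact: par_one.
- exact: par0.
- move=> V s oV VU; rewrite /cmul /opD /opM res_one // res_zero //.
  by rewrite mul0r addr0 mul1r.
Qed.

Section Forward.
Variables (R : realType) (k l : nat) (B : supermanifold R k l).
Variables (M : super_Riemann_surface B) (n : nat) (N : Kaehler_family B n).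
Variable (Phi : family_map M N).

(** The hypothesis J dPhi (I X) = - dPhi X relates I X to - X; three rotations
    turn this into the relation between X and I X. *)
Lemma generator_related (U : set M) (X : op M) x : super_J_holomorphic Phi ->
  open U -> U x -> odd_generator (@srs_D _ _ _ _ M) U X ->
  forall c F, complex_frame c F -> dom c (Phi x) ->
  exists U1, [/\ open U1, U1 x, U1 `<=` U, U1 `<=` Phi @^-1` dom c &
    complex_related Phi c F U1 X (cJ X)].
Proof.
move=> sJ oU Ux gX c F cF cx.
have vX := gen_vf gX; have vJX := cJ_vfield oU vX.
have [w [Jw Xw]] := sJ U true X oU vX (generator_section oU gX).
have wX V (f : sec N V) : open V -> w V f = differential Phi U (opN X) V f.
  move=> oV; move: (Xw V f oV); rewrite /differential /opN => /(congr1 (fun t => t + t)).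
  rewrite -mulrDr cst_half addr0 => /eqP; rewrite addrC addr_eq0 => /eqP //.
have [U1 [oU1 U1x U1U U1c r1]] :=
  is_J_complex_related cF oU vJX (vfieldN oU vX) Jw wX Ux cx.
exists U1; split=> //.
have r2 := related_rotate oU1 (related_rotate oU1 (related_rotate oU1 r1)).
by apply: related_ext r2 => V s oV VU1; rewrite /opN opprK.
Qed.

Lemma super_J_holomorphic_map : super_J_holomorphic Phi -> holomorphic_map Phi.
Proof.
move=> sJ U p X oU vX; apply: (is_J_differential oU vX (cJ_vfield oU vX)) => x Ux.
have [U0 [X0 [_ [oU0 U0x gX0 [vX0 hX0] _]]]] :=
  distr_generator (srs_distribution M) x.
have [cM [E [cMx fE JE]]] := cJ_integrable x.
have [c [F [cx fF JF]]] := cJ_integrable (Phi x).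
have cE : complex_frame cM E by split.
have cF : complex_frame c F by split.
have [U1 [oU1 U1x U10 U1c r1]] := generator_related sJ oU0 U0x gX0 cF cx.
pose V := U1 `&` (U `&` dom cM).
have oV : open V by apply: openI => //; apply: openI => //; apply: dom_open.
have VU1 : V `<=` U1 by move=> y [].
have VU0 : V `<=` U0 by move=> y /VU1/U10.
have VU : V `<=` U by move=> y [_ []].
have VcM : V `<=` dom cM by move=> y [_ []].
have Vc : V `<=` Phi @^-1` dom c by move=> y /VU1/U1c.
have vXV := vfield_sub VU vX; have vX0V := vfield_sub VU0 vX0.
have vJX0V := cJ_vfield oV vX0V.
have r0 := related_sub VU1 r1.
have sq A s : open A -> A `<=` V -> cJ X0 A (cJ X0 A s) = - X0 A (X0 A s).
  move=> oA AV; have AU0 := subset_trans AV VU0.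
  apply: (holomorphic_cJ_square cE _ oA (subset_trans AV VcM)).
  split; first exact: vfield_sub vX0.
  by move=> A' q Y oA' A'A; apply: hX0 => //; apply: subset_trans AU0.
pose H := opZ 2^-1 (bracket true true X0 X0).
have vbr := vfield_bracket vX0V vX0V.
have vH : vfield false V H by apply: vfieldZ.
have rH : complex_related Phi c F V H (cJ H).
  apply: related_ext (related_square cF oV Vc vX0V vJX0V r0 sq) => // A s oA AV.
  rewrite (cJ_scale _ oV vbr) // /opZ; congr (_ * _).
  by apply: (hX0 V true X0).
(* X = (f H + g I H) + (f' X0 + g' I X0) near x. *)
have [span _] := srs_nonintegrable oU0 gX0 p oV VU0.
have [f [g [pf pg DX]]] := span X vXV.
have vfH := vfield_cmul oV pf pg vH; rewrite addbF in vfH.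
have vdiff := vfieldB oV vXV vfH.
have [f' [g' [pf' pg' eX]]] := (gen_span gX0 oV VU0 vdiff).1 DX.
have vfX := vfield_cmul oV pf' pg' vX0V; rewrite addNb addbT negbK in vfX.
have XE : op_eq V (opD (cmul f g H) (cmul f' g' X0)) X.
  by move=> A s oA AV; rewrite /opD -(eX A s oA AV) /opB addrC subrK.
have rX := relatedD (related_cmul oV pf pg vH rH) (related_cmul oV pf' pg' vX0V r0).
exists V, c, F; split=> //.
split=> //; apply: related_ext rX => // A s oA AV.
by rewrite -(cJ_ext oV (vfieldD vfH vfX) XE) // (cJ_add oV vfH vfX).
Qed.

End Forward.

Lemma holomorphic_map_super_J (R : realType) (k l : nat) (B : supermanifold R k l)
    (M : super_Riemann_surface B) (n : nat) (N : Kaehler_family B n)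
    (Phi : family_map M N) : holomorphic_map Phi -> super_J_holomorphic Phi.
Proof.
move=> hol U p X oU vX _; exists (differential Phi U (cJ (cJ X))); split.
  by apply: (hol U p) => //; apply: cJ_vfield.
move=> V f oV; rewrite /differential (cJ_cJ oU vX) //.
- by rewrite /opN subrr mulr0.
- exact: open_setI_preimage.
Qed.

Theorem lemma2p3p6 (R : realType) (k l : nat) (B : supermanifold R k l)
    (M : super_Riemann_surface B) (n : nat) (N : Kaehler_family B n)
    (Phi : family_map M N) :
  super_J_holomorphic Phi <-> holomorphic_map Phi.
Proof.
split; first exact: super_J_holomorphic_map.
exact: holomorphic_map_super_J.
Qed.
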